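(* Let $\mu_1$ and $\mu_2$ be Borel probability measures on $\mathbb{R}_+=[0,+\infty)$, neither of which is a point mass, and let $\mu=\mu_1\boxtimes\mu_2$. Set $k_j(z)=\eta_{\mu_j}(z)/z$, $j=1,2$. Then $|\varphi_t'(\omega_2(t))|<1$ for every $t<0$; equivalently, \[|t^2k_1'(\omega_1(t))k_2'(\omega_2(t))|<1,\quad t\in(-\infty,0).\]
   Context: For a Borel probability measure $\nu\neq\delta_0$ on $\mathbb{R}_+$, $\psi_\nu(z)=\int_{\mathbb{R}_+}\frac{zs\,d\nu(s)}{1-zs}$ and $\eta_\nu(z)=\psi_\nu(z)/(1+\psi_\nu(z))$ for $z\in\mathbb{C}\setminus\mathbb{R}_+$; ${\rm Eta}_{\mathbb{R}_+}$ is the set of all such $\eta_\nu$ (each maps $(-\infty,0)$ into $(-\infty,0)$). The free multiplicative convolution $\mu_1\boxtimes\mu_2$ is the distribution of $x_2^{1/2}x_1x_2^{1/2}$ for freely independent positive operators $x_1,x_2$ affiliated with a tracial $W^*$-probability space, with distributions $\mu_1,\mu_2$. The subordination functions $\omega_1,\omega_2$ are the unique functions in ${\rm Eta}_{\mathbb{R}_+}$ such that $\eta_\mu(z)=\eta_{\mu_1}(\omega_1(z))=\eta_{\mu_2}(\omega_2(z))=\omega_1(z)\omega_2(z)/z$ for $z$ in the upper half-plane $\mathbb{H}$. For $t<0$, $\varphi_t$ denotes the map $\varphi_t(z)=tk_1(tk_2(z))$ on $\mathbb{C}\setminus\mathbb{R}_+$, which fixes $\omega_2(t)$. *)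

(* Defs.v *)
From HB Require Import structures.
From mathcomp Require Import all_boot all_order all_algebra.
From mathcomp Require Import all_classical all_reals all_analysis.
From mathcomp Require Import complex.
Set Implicit Arguments. Unset Strict Implicit. Unset Printing Implicit Defensive.
Import Order.TTheory GRing.Theory Num.Theory.
Import numFieldNormedType.Exports.
Local Open Scope classical_set_scope.
Local Open Scope ring_scope.
Local Open Scope complex_scope.

Definition cintegral (R : realType) (nu : probability R R) (D : set R)
    (f : R -> R[i]) : R[i] :=
  (Rintegral nu D (fun s => complex.Re (f s)))%:C +
  'i * (Rintegral nu D (fun s => complex.Im (f s)))%:C.

Definition in_Rplus (R : realType) (z : R[i]) : Prop :=
  complex.Im z = 0 /\ 0 <= complex.Re z.

Definition supported_Rplus (R : realType) (nu : probability R R) : Prop :=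
  nu [set x : R | x < 0] = 0%E.

Definition is_point_mass (R : realType) (nu : probability R R) : Prop :=
  exists a : R, forall A : set R, measurable A -> nu A = \d_a A.

Definition is_delta0 (R : realType) (nu : probability R R) : Prop :=
  forall A : set R, measurable A -> nu A = \d_(0:R) A.

Definition psiR (R : realType) (nu : probability R R) (z : R[i]) : R[i] :=
  cintegral nu [set x : R | 0 <= x] (fun s => z * s%:C / (1 - z * s%:C)).

Definition etaR (R : realType) (nu : probability R R) (z : R[i]) : R[i] :=
  psiR nu z / (1 + psiR nu z).

Definition in_Eta (R : realType) (f : R[i] -> R[i]) : Prop :=
  exists nu : probability R R,
    [/\ supported_Rplus nu, ~ is_delta0 nu &
        forall z, ~ in_Rplus z -> f z = etaR nu z].

Definition kfun (R : realType) (nu : probability R R) (z : R[i]) : R[i] :=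
  etaR nu z / z.

Definition phi (R : realType) (nu1 nu2 : probability R R) (t : R) (z : R[i])
  : R[i] := t%:C * kfun nu1 (t%:C * kfun nu2 z).

Definition cderive (R : realType) (f : R[i] -> R[i]) (z : R[i]) : R[i] :=
  @derive1 (R[i] : numFieldType) (R[i]^o) f z.

(* Main.v *)
Require Import Defs.
From HB Require Import structures.
From mathcomp Require Import all_boot all_order all_algebra.
From mathcomp Require Import all_classical all_reals all_analysis.
From mathcomp Require Import measurable_realfun complex.
From mathcomp Require Import ring lra.
Import Order.TTheory GRing.Theory Num.Theory.
Import numFieldNormedType.Exports.
Local Open Scope classical_set_scope.
Local Open Scope ring_scope.
Local Open Scope complex_scope.

(** For [x = - y < 0] put [u s = y s / (1 + y s)], a random variable with values
in [[0, 1)] under [nu], with mean [m] and variance [V]. Then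
[eta (x) = - m / (1 - m)], and [k (x) = eta (x) / x] satisfies
[x k'(x) / k (x) = E[u (1 - u)] / (m (1 - m)) - 1 = - V / (m (1 - m))], which
lies in [(-1, 0]] unless [nu] is the point mass at 0. The subordination
equations extend to [t < 0] by continuity and give [t k1 (w1) = w2] and
[t k2 (w2) = w1] for [w1 = omega1 (t)] and [w2 = omega2 (t)], hence
[t^2 k1'(w1) k2'(w2) = (w1 k1'(w1) / k1 (w1)) (w2 k2'(w2) / k2 (w2))]. *)

(** * Derivatives and continuity in one variable over a numeric field *)

Lemma is_derive_quadratic (K : numFieldType) (f : K -> K) (a d e C : K) :
  0 < e -> 0 < C ->
  (forall h, `|h| < e -> `|f (a + h) - f a - h * d| <= C * `|h| ^+ 2) ->
  is_derive (a : K^o) (1 : K^o) (f : K^o -> K^o) d.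
Proof.
move=> e0 C0 fd.
have fcvg : (fun h : K^o => h^-1 *: ((f \o shift a) (h *: (1 : K^o)) - f a))
    @ 0^' --> (d : K^o).
  apply/cvgrPdist_lt => eps eps0; near=> h.
  have h0 : h != 0 by near: h; exact: nbhs_dnbhs_neq.
  have he : `|h| < e by near: h; apply: dnbhs0_lt.
  have hE : `|h| < eps / C by near: h; apply: dnbhs0_lt; rewrite divr_gt0.
  rewrite /= [h *: _]mulr1 (addrC h).
  (* The error of the difference quotient is the second-order remainder divided by [h], hence at
     most [C * |h|]. *)
  have -> : d - h^-1 *: (f (a + h) - f a)
      = - (h^-1 * (f (a + h) - f a - h * d)).
    by rewrite mulrBr mulKf // opprB.
  rewrite normrN normrM normfV; apply: le_lt_trans (_ : C * `|h| < _).
    rewrite ler_pdivrMl ?normr_gt0 // mulrCA -expr2.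
    exact: fd.
  by rewrite mulrC -ltr_pdivlMr.
apply: DeriveDef; first by apply/cvg_ex; exists d.
exact: cvg_lim fcvg.
Unshelve. all: by end_near. Qed.

Lemma is_derive1_comp (K : numFieldType) (f g : K -> K) (a df dg : K) :
  is_derive (a : K^o) (1 : K^o) (f : K^o -> K^o) df ->
  is_derive (f a : K^o) (1 : K^o) (g : K^o -> K^o) dg ->
  is_derive (a : K^o) (1 : K^o) (g \o f : K^o -> K^o) (dg * df).
Proof.
move=> [/derivable1_diffP Df <-] [/derivable1_diffP Dg <-].
have Dgf : differentiable (g \o f : K^o -> K^o) (a : K^o).
  exact: (@differentiable_comp K K^o K^o K^o).
apply: DeriveDef; first exact/derivable1_diffP.
rewrite (deriveE _ Dgf) (deriveE _ Df) (deriveE _ Dg).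
rewrite (diff_comp Df Dg) /=.
(* Writing the argument as a multiple of [1] lets linearity of the differential of [g] pull it out
   as a factor. *)
rewrite -[X in 'd  _ _ X = _]mulr1.
by rewrite [LHS]linearZ mulrC.
Qed.

Lemma is_derive_invr (K : numFieldType) (f : K -> K) (a df : K) :
  f a != 0 ->
  is_derive (a : K^o) (1 : K^o) (f : K^o -> K^o) df ->
  is_derive (a : K^o) (1 : K^o) ((fun z => (f z)^-1) : K^o -> K^o)
    (- (f a) ^- 2 * df).
Proof.
move=> fa0 [Df <-]; apply: DeriveDef.
  exact: (@derivableV K K^o).
exact: (@deriveV K K^o).
Qed.

Lemma is_derive_mulr (K : numFieldType) (f g : K -> K) (a df dg : K) :
  is_derive (a : K^o) (1 : K^o) (f : K^o -> K^o) df ->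
  is_derive (a : K^o) (1 : K^o) (g : K^o -> K^o) dg ->
  is_derive (a : K^o) (1 : K^o) ((fun z => f z * g z) : K^o -> K^o)
    (f a * dg + g a * df).
Proof. by move=> Df Dg; exact: (@is_deriveM K K^o f g a 1 df dg). Qed.

Lemma is_derive_continuous (K : numFieldType) (f : K -> K) (a df : K) :
  is_derive (a : K^o) (1 : K^o) (f : K^o -> K^o) df ->
  {for (a : K^o), continuous (f : K^o -> K^o)}.
Proof.
by move=> [/derivable1_diffP /differentiable_continuous].
Qed.

(** The function is the subordination equation with its division by [z] cleared; its continuity at
    [t] carries the equation from the upper half-plane to [t]. *)
Lemma continuous_subordination (K : numFieldType) (f h p q : K -> K) (a : K) :
  {for (a : K^o), continuous (h : K^o -> K^o)} ->
  {for (h a : K^o), continuous (f : K^o -> K^o)} ->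
  {for (a : K^o), continuous (p : K^o -> K^o)} ->
  {for (a : K^o), continuous (q : K^o -> K^o)} ->
  {for (a : K^o), continuous ((fun z => f (h z) * z - p z * q z) : K^o -> K^o)}.
Proof.
move=> ch cf cp cq.
have cfh : {for (a : K^o), continuous (f \o h : K^o -> K^o)}.
  exact: (@continuous_comp K^o K^o K^o h f).
have cid : {for (a : K^o), continuous (id : K^o -> K^o)} by exact: cvg_id.
exact: (@cvgB K K^o _ _ _ _ _ _ _ (cvgM cfh cid) (cvgM cp cq)).
Qed.

Lemma normc_real (R : realType) (x : R) : `|x%:C| = `|x|%:C :> R[i].
Proof. by rewrite normc_def /= expr0n addr0 sqrtr_sqr. Qed.

(** On nonnegative reals the inverse is the power with exponent [-1], also at 0, where both are
    0. *)
Lemma measurable_inv_ge0 d (T : measurableType d) (R : realType) (D : set T)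
    (f : T -> R) :
  (forall x, 0 <= f x) -> measurable_fun D f ->
  measurable_fun D (fun x => (f x)^-1).
Proof.
move=> f0 mf.
rewrite (_ : (fun x => _) = (@powR R ^~ (-1)) \o f); last first.
  by apply/funext => x /=; rewrite powR_inv1.
exact: (measurableT_comp (measurable_powR (-1)) mf).
Qed.

(** * Measurability, integrability and bounds for complex-valued integrands, by real and imaginary
    parts *)

Section complex_integral.
Context (R : realType) (nu : probability R R) (D : set R).
Hypothesis mD : measurable D.

Definition cmeasurable (f : R -> R[i]) : Prop :=
  measurable_fun D (fun s => complex.Re (f s)) /\
  measurable_fun D (fun s => complex.Im (f s)).

Lemma cmeasurable_cst (c : R[i]) : cmeasurable (fun=> c).
Proof. by split; exact: measurable_cst. Qed.

Lemma cmeasurable_id : cmeasurable (fun s => s%:C).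
Proof. by split; [exact: measurable_id | exact: measurable_cst]. Qed.

Lemma cmeasurableB (f g : R -> R[i]) :
  cmeasurable f -> cmeasurable g -> cmeasurable (fun s => f s - g s).
Proof.
move=> [f1 f2] [g1 g2]; split.
  rewrite (_ : (fun s => _) = (fun s => complex.Re (f s) - complex.Re (g s))).
    exact: measurable_funB.
  by apply/funext => s; case: (f s) (g s) => [? ?] [].
rewrite (_ : (fun s => _) = (fun s => complex.Im (f s) - complex.Im (g s))).
  exact: measurable_funB.
by apply/funext => s; case: (f s) (g s) => [? ?] [].
Qed.

Lemma cmeasurableM (f g : R -> R[i]) :
  cmeasurable f -> cmeasurable g -> cmeasurable (fun s => f s * g s).
Proof.
move=> [f1 f2] [g1 g2]; split.
  rewrite (_ : (fun s => _) = (fun s => complex.Re (f s) * complex.Re (g s)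
                                   - complex.Im (f s) * complex.Im (g s))).
    by apply: measurable_funB; exact: measurable_funM.
  by apply/funext => s; case: (f s) (g s) => [? ?] [].
rewrite (_ : (fun s => _) = (fun s => complex.Re (f s) * complex.Im (g s)
                                 + complex.Im (f s) * complex.Re (g s))).
  by apply: measurable_funD; exact: measurable_funM.
by apply/funext => s; case: (f s) (g s) => [? ?] [].
Qed.

Lemma cmeasurableV (f : R -> R[i]) :
  cmeasurable f -> cmeasurable (fun s => (f s)^-1).
Proof.
move=> [f1 f2].
(* Both parts of the inverse have the squared modulus as denominator, which is nonnegative. *)
have mN : measurable_fun D
    (fun s => (complex.Re (f s) ^+ 2 + complex.Im (f s) ^+ 2)^-1).
  apply: measurable_inv_ge0 => [s|]; first by rewrite addr_ge0 ?sqr_ge0.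
  by apply: measurable_funD; exact: measurable_funX.
split.
  rewrite (_ : (fun s => _) = (fun s => complex.Re (f s) *
      (complex.Re (f s) ^+ 2 + complex.Im (f s) ^+ 2)^-1)).
    exact: measurable_funM.
  by apply/funext => s; case: (f s).
rewrite (_ : (fun s => _) = (fun s => - (complex.Im (f s) *
    (complex.Re (f s) ^+ 2 + complex.Im (f s) ^+ 2)^-1))).
  by apply: measurableT_comp => //; exact: measurable_funM.
by apply/funext => s; case: (f s).
Qed.

Definition cintegrable (f : R -> R[i]) : Prop :=
  nu.-integrable D (EFin \o (fun s => complex.Re (f s))) /\
  nu.-integrable D (EFin \o (fun s => complex.Im (f s))).

Lemma bounded_Rintegrable (f : R -> R) (M : R) :
  measurable_fun D f -> (forall s, D s -> `|f s| <= M) ->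
  nu.-integrable D (EFin \o f).
Proof.
move=> mf fM; apply: measurable_bounded_integrable => //.
  by apply: (le_lt_trans (probability_le1 nu mD)); rewrite ltry.
exists M; split; first exact: num_real.
by move=> y My s Ds /=; apply: le_trans (ltW My); exact: fM.
Qed.

Lemma normc_ge_Im (z : R[i]) : `|complex.Im z|%:C <= `|z|.
Proof.
case: z => a b; rewrite normc_def /= lecR -sqrtr_sqr.
by rewrite ler_sqrt ?addr_ge0 ?sqr_ge0 // lerDr sqr_ge0.
Qed.

Lemma bounded_cintegrable (f : R -> R[i]) (M : R) :
  cmeasurable f -> (forall s, D s -> `|f s| <= M%:C) -> cintegrable f.
Proof.
move=> [f1 f2] fM; split; apply: (@bounded_Rintegrable _ M) => // s Ds;
  rewrite -lecR; apply: le_trans (fM s Ds).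
  exact: normc_ge_Re.
exact: normc_ge_Im.
Qed.

Lemma cintegrableB (f g : R -> R[i]) :
  cintegrable f -> cintegrable g -> cintegrable (fun s => f s - g s).
Proof.
move=> [f1 f2] [g1 g2]; split.
  apply: eq_integrable (integrableB mD f1 g1) => // s _ /=.
  by case: (f s) (g s) => [? ?] [].
apply: eq_integrable (integrableB mD f2 g2) => // s _ /=.
by case: (f s) (g s) => [? ?] [].
Qed.

Lemma cintegralB (f g : R -> R[i]) : cintegrable f -> cintegrable g ->
  cintegral nu D (fun s => f s - g s) = cintegral nu D f - cintegral nu D g.
Proof.
move=> [f1 f2] [g1 g2]; rewrite /cintegral.
have -> : Rintegral nu D (fun s => complex.Re (f s - g s)) =
    Rintegral nu D (fun s => complex.Re (f s)) -
    Rintegral nu D (fun s => complex.Re (g s)).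
  rewrite -RintegralB //; apply: eq_Rintegral => s _.
  by case: (f s) (g s) => [? ?] [].
have -> : Rintegral nu D (fun s => complex.Im (f s - g s)) =
    Rintegral nu D (fun s => complex.Im (f s)) -
    Rintegral nu D (fun s => complex.Im (g s)).
  rewrite -RintegralB //; apply: eq_Rintegral => s _.
  by case: (f s) (g s) => [? ?] [].
by rewrite !rmorphB; ring.
Qed.

Lemma cintegral_real (g : R -> R) :
  cintegral nu D (fun s => (g s)%:C) = (Rintegral nu D g)%:C.
Proof.
rewrite /cintegral /=.
have -> : Rintegral nu D (fun=> 0) = 0 by rewrite Rintegral_cst ?mul0r.
by rewrite mulr0 addr0.
Qed.

Lemma cintegralZr (c : R[i]) (g : R -> R) :
  nu.-integrable D (EFin \o g) ->
  cintegral nu D (fun s => c * (g s)%:C) = c * (Rintegral nu D g)%:C.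
Proof.
move=> ig; rewrite /cintegral.
have -> : Rintegral nu D (fun s => complex.Re (c * (g s)%:C)) =
    complex.Re c * Rintegral nu D g.
  rewrite -RintegralZl //; apply: eq_Rintegral => s _.
  by case: c => a b /=; rewrite mulr0 subr0.
have -> : Rintegral nu D (fun s => complex.Im (c * (g s)%:C)) =
    complex.Im c * Rintegral nu D g.
  rewrite -RintegralZl //; apply: eq_Rintegral => s _.
  by case: c => a b /=; rewrite mulr0 add0r.
by rewrite [in RHS](complexE c) !rmorphM mulrDl mulrA.
Qed.

(** The mass of [D] is at most 1. The bound is [|M|] because for empty [D] the hypothesis allows
    [M < 0]. *)
Lemma normr_Rintegral_le (f : R -> R) (M : R) : measurable_fun D f ->
  (forall s, D s -> `|f s| <= M) -> `|Rintegral nu D f| <= `|M|.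
Proof.
move=> mf fM; have If := bounded_Rintegrable _ _ mf fM.
apply: (le_trans (le_normr_Rintegral mD If)).
have IM : nu.-integrable D (EFin \o (fun=> `|M|)).
  by apply: (@bounded_Rintegrable _ `|M|) => // s _; rewrite normr_id.
have In : nu.-integrable D (EFin \o (fun s => `|f s|)).
  apply: (@bounded_Rintegrable _ `|M|).
    exact: measurableT_comp.
  by move=> s Ds; rewrite normr_id (le_trans (fM s Ds)) ?ler_norm.
apply: (@le_trans _ _ (Rintegral nu D (fun=> `|M|))).
  apply: le_Rintegral => // s Ds.
  by rewrite (le_trans (fM s Ds)) ?ler_norm.
rewrite Rintegral_cst //.
rewrite ler_piMr // -lee_fin fineK ?probability_le1 //.
exact: fin_num_measure.
Qed.

(** The factor 2 comes from bounding the real and imaginary parts separately; this is sharp enough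
    for a quadratic remainder. *)
Lemma normc_cintegral_le (f : R -> R[i]) (M : R) : cmeasurable f ->
  (forall s, D s -> `|f s| <= M%:C) -> `|cintegral nu D f| <= (`|M| *+ 2)%:C.
Proof.
move=> [f1 f2] fM; rewrite /cintegral.
apply: (le_trans (ler_normD _ _)); rewrite mulr2n rmorphD /= normrM.
have -> : `|'i : R[i]| = 1 by rewrite normc_def /= expr0n expr1n add0r sqrtr1.
rewrite mul1r.
rewrite !normc_real lerD // lecR; apply: normr_Rintegral_le => // s Ds;
  rewrite -lecR; apply: le_trans (fM s Ds).
  exact: normc_ge_Re.
exact: normc_ge_Im.
Qed.

End complex_integral.

Arguments cmeasurable {R} D f.
Arguments cintegrable {R} nu D f.

(** * Probability measures on the half-line and their transforms on the negative axis *)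

Section psi_negative.
Context (R : realType) (nu : probability R R).
Hypothesis nu_supp : supported_Rplus nu.
Local Notation D := [set x : R | 0 <= x].

Lemma measurable_Rplus : measurable D.
Proof. by rewrite -set_itvcy; exact: measurable_itv. Qed.

Lemma Rplus_full : nu D = 1%E.
Proof.
have -> : D = ~` [set x : R | x < 0].
  by apply/seteqP; split => x /=; rewrite leNgt => /negP.
rewrite probability_setC ?nu_supp ?sube0 //.
by rewrite -set_itvNyo; exact: measurable_itv.
Qed.

Lemma Rintegral_Rplus_cst (c : R) : Rintegral nu D (fun=> c) = c.
Proof.
rewrite Rintegral_cst; last exact: measurable_Rplus.
by rewrite [X in fine X]Rplus_full mulr1.
Qed.

(** A measurable set that misses 0 lies in the union of two null half-lines; a set that contains 0
    is handled through its complement. *)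
Lemma null_pos_delta0 : nu [set x : R | 0 < x] = 0%E -> is_delta0 nu.
Proof.
move=> nu0.
have mp : measurable [set x : R | 0 < x].
  by rewrite -set_itvoy; exact: measurable_itv.
have mn : measurable [set x : R | x < 0].
  by rewrite -set_itvNyo; exact: measurable_itv.
have null (A : set R) : measurable A -> ~ A 0 -> nu A = 0%E.
  move=> mA A0; apply/eqP; rewrite eq_le measure_ge0 andbT.
  have <- : nu ([set x : R | 0 < x] `|` [set x | x < 0]) = 0%E.
    by apply: (etrans (measureU0 mp mn nu_supp)) nu0.
  apply: le_measure; rewrite ?inE //; first exact: measurableU.
  move=> x Ax /=; case: (ltgtP x 0) => [|| x0]; [by right|by left|].
  by case: A0; rewrite -x0.
move=> A mA; rewrite diracE; have [A0|A0] := boolP (0 \in A).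
  have := null (~` A) (measurableC mA).
  rewrite inE in A0; move=> /(_ (fun nA => nA A0)).
  rewrite probability_setC //.
  by move/eqP; rewrite sube_eq ?add0e // => /eqP.
by rewrite null //; move=> A0'; move/negP: A0; apply; rewrite inE.
Qed.

(** A nonnegative function with zero integral vanishes almost everywhere, so the positive half-line
    would be null. Positivity is asked only for [0 < s] because the integrands in view vanish at
    0. *)
Lemma Rintegral_Rplus_gt0 (f : R -> R) (M : R) : ~ is_delta0 nu ->
  measurable_fun D f -> (forall s, 0 <= s -> 0 <= f s <= M) ->
  (forall s, 0 < s -> 0 < f s) -> 0 < Rintegral nu D f.
Proof.
move=> nd mf fM fp.
have fge0 s : D s -> 0 <= f s by move=> /fM /andP[].
have If : nu.-integrable D (EFin \o f).
  apply: (@bounded_Rintegrable _ _ _ measurable_Rplus _ M) => // s /fM /andP[f0 ?].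
  by rewrite ger0_norm.
rewrite lt_neqAle Rintegral_ge0 // andbT eq_sym; apply/eqP => I0; apply: nd.
have IE : (\int[nu]_(x in D) `|(f x)%:E| = 0)%E.
  have -> : (\int[nu]_(x in D) `|(f x)%:E| = \int[nu]_(x in D) (f x)%:E)%E.
    by apply: eq_integral => x; rewrite inE => /fge0 f0; rewrite /= ger0_norm.
  have := integrable_fin_num measurable_Rplus If.
  by move=> /fineK <-; congr (_%:E).
have mfE : measurable_fun D (EFin \o f) by exact/measurable_EFinP.
have /(ae_eq_integral_abs nu measurable_Rplus mfE) := IE.
move=> [N [mN N0 sub]]; apply: null_pos_delta0.
apply: (subset_measure0 _ mN _ N0).
  by rewrite -set_itvoy; exact: measurable_itv.
move=> s /= s0; apply: sub => /= /(_ (ltW s0)) [] fs0.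
by have := fp s s0; rewrite fs0 ltxx.
Qed.

(** * Values and derivatives of psi, eta and k at the point [- y] *)

Section at_point.
Variable y : R.
Hypothesis y0 : 0 < y.

Let u (s : R) : R := y * s / (1 + y * s).

Lemma den_gt0 (s : R) : D s -> 0 < 1 + y * s.
Proof. by move=> s0; rewrite ltr_wpDr // mulr_ge0 // ltW. Qed.

Lemma u_bound (s : R) : D s -> 0 <= u s <= 1.
Proof.
move=> s0; have d0 := den_gt0 s s0.
rewrite /u ler_pdivrMr // mul1r lerDr ler01 andbT.
by rewrite divr_ge0 ?(ltW d0) // mulr_ge0 // ltW.
Qed.

Lemma measurable_u : measurable_fun D u.
Proof.
apply: measurable_funM; first by apply: measurable_funM.
(* The absolute value makes the denominator nonnegative on the whole line and changes nothing on
   [D]. *)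
have mi : measurable_fun D (fun s : R => `|1 + y * s|^-1).
  apply: measurable_inv_ge0 => //.
  apply: measurableT_comp => //.
  by apply: measurable_funD => //; exact: measurable_funM.
apply: eq_measurable_fun mi => s; rewrite inE => Ds.
by rewrite gtr0_norm // den_gt0.
Qed.

Let m : R := Rintegral nu D u.
Let v : R := Rintegral nu D (fun s => u s * (1 - u s)).

Lemma integrable_u : nu.-integrable D (EFin \o u).
Proof.
apply: (@bounded_Rintegrable _ _ _ measurable_Rplus _ 1 measurable_u).
by move=> s /u_bound /andP[u0 u1]; rewrite ger0_norm.
Qed.

Lemma measurable_uV : measurable_fun D (fun s => u s * (1 - u s)).
Proof.
apply: measurable_funM; first exact: measurable_u.
by apply: measurable_funB => //; exact: measurable_u.
Qed.

Lemma integrable_uV : nu.-integrable D (EFin \o (fun s => u s * (1 - u s))).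
Proof.
apply: (@bounded_Rintegrable _ _ _ measurable_Rplus _ 1 measurable_uV).
by move=> s /u_bound /andP[u0 u1]; rewrite ger0_norm; nra.
Qed.

Lemma mean_gt0 : ~ is_delta0 nu -> 0 < m.
Proof.
move=> nd; apply: (@Rintegral_Rplus_gt0 _ 1 nd measurable_u).
  by move=> s /u_bound.
by move=> s s0; rewrite /u divr_gt0 ?mulr_gt0 ?den_gt0 //; exact: ltW.
Qed.

Lemma meanV_gt0 : ~ is_delta0 nu -> 0 < v.
Proof.
move=> nd; apply: (@Rintegral_Rplus_gt0 _ 1 nd measurable_uV).
  by move=> s /u_bound /andP[? ?]; apply/andP; split; nra.
move=> s s0; have d0 := den_gt0 s (ltW s0).
have -> : u s * (1 - u s) = y * s / (1 + y * s) ^+ 2.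
  by rewrite /u; field; rewrite gt_eqF.
by rewrite divr_gt0 ?mulr_gt0 ?exprn_gt0.
Qed.

(* [m * (1 - m) - v] is the variance of [u]. *)
Lemma meanV_le : v <= m * (1 - m).
Proof.
have Ic (c : R) : nu.-integrable D (EFin \o (fun=> c)).
  exact: (@bounded_Rintegrable _ _ _ measurable_Rplus _ `|c|).
have Iu := integrable_u; have Iv := integrable_uV.
have Iw : nu.-integrable D (EFin \o (fun s => (1 - 2 * m) * u s)).
  have -> : EFin \o (fun s => (1 - 2 * m) * u s)
    = (fun s => (1 - 2 * m)%:E * (EFin \o u) s)%E by apply/funext.
  exact: (integrableZl measurable_Rplus (1 - 2 * m) Iu).
have Iw' : nu.-integrable D (EFin \o (fun s => (1 - 2 * m) * u s + m ^+ 2)).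
  exact: (integrableD measurable_Rplus Iw (Ic _)).
have : v <= Rintegral nu D (fun s => (1 - 2 * m) * u s + m ^+ 2).
  apply: le_Rintegral => //; first exact: measurable_Rplus.
  (* The inequality is [(u s - m) ^+ 2 >= 0] expanded; its right side integrates to
     [(1 - 2 * m) * m + m ^+ 2 = m * (1 - m)]. *)
  by move=> s _; have := sqr_ge0 (u s - m); nra.
rewrite RintegralD //; last exact: measurable_Rplus.
rewrite RintegralZl //; last exact: measurable_Rplus.
rewrite Rintegral_Rplus_cst -/m; nra.
Qed.

(** From [0 < v <= m * (1 - m)] and [0 < m] the factor [1 - m] must be positive. This makes the
    denominator of eta nonzero at [- y]. *)
Lemma mean_lt1 : ~ is_delta0 nu -> m < 1.
Proof.
move=> nd; have := meanV_gt0 nd; have := mean_gt0 nd; have := meanV_le.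
by move=> vm m0 v0; rewrite -subr_gt0 -(pmulr_rgt0 _ m0) (lt_le_trans v0 vm).
Qed.

Lemma psiR_neg : psiR nu (- y)%:C = (- m)%:C.
Proof.
rewrite /psiR.
have -> : (fun s : R => (- y)%:C * s%:C / (1 - (- y)%:C * s%:C))
    = (fun s => ((-1) * u s)%:C).
  apply/funext => s; rewrite /u.
  by rewrite -(rmorph1 (real_complex R)) -!rmorphM -rmorphB -fmorphV -rmorphM /=;
    congr (_%:C); rewrite !mulNr opprK mul1r.
rewrite cintegral_real; last exact: measurable_Rplus.
rewrite RintegralZl ?mulN1r //; [exact: measurable_Rplus | exact: integrable_u].
Qed.

(** The integrand has [z]-derivative [s / (1 - z s)^2], which at [z = - y] equals
    [u s * (1 - u s) / y]. An explicit second-order remainder, uniform in [s], justifies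
    differentiating under the integral. *)
Lemma is_derive_psiR_neg :
  is_derive ((- y)%:C : R[i]^o) (1 : R[i]^o) (psiR nu : R[i]^o -> R[i]^o)
    (v / y)%:C.
Proof.
have mD := measurable_Rplus.
(* Radius [y] keeps [Re z <= 0], so [|1 - z s| >= 1] for all [s >= 0]. The pointwise remainder is
   then at most [|h|^2 / y^2], and the 2 is the loss in [normc_cintegral_le]. *)
apply: (@is_derive_quadratic _ _ _ _ y%:C (2 / y ^+ 2)%:C).
- by rewrite ltcR.
- by rewrite ltcR divr_gt0 ?exprn_gt0.
move=> h hy.
have [n [n0 nE]] : exists n : R, 0 <= n /\ `|h| = n%:C.
  exists (Num.sqrt (complex.Re h ^+ 2 + complex.Im h ^+ 2)).
  by rewrite sqrtr_ge0 normc_def.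
rewrite nE ltcR in hy.
set z := (- y)%:C + h.
have Rez : complex.Re z <= 0.
  have : `|complex.Re h|%:C <= `|h| by exact: normc_ge_Re.
  rewrite nE lecR => /(le_trans (ler_norm _)) hn.
  have -> : complex.Re z = - y + complex.Re h by rewrite /z; case: (h).
  by nra.
have den1 s : D s -> 1 <= `|1 - z * s%:C|.
  move=> s0; apply: le_trans (normc_ge_Re _); rewrite -[1]/(1%:C) lecR.
  apply: le_trans (ler_norm _).
  have -> : complex.Re (1 - z * s%:C) = 1 - complex.Re z * s.
    by case: (z) => a b /=; rewrite mulr0 subr0.
  by move: s0 => /= s0; nra.
have den0 s : D s -> 1 - z * s%:C != 0.
  by move=> /den1 d1; rewrite -normr_gt0; apply: lt_le_trans d1.
have mden (w : R[i]) : cmeasurable D (fun s => (1 - w * s%:C)^-1).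
  apply: cmeasurableV; apply: cmeasurableB; first exact: cmeasurable_cst.
  by apply: cmeasurableM; [exact: cmeasurable_cst|exact: cmeasurable_id].
have mint (w : R[i]) : cmeasurable D (fun s => w * s%:C / (1 - w * s%:C)).
  apply: cmeasurableM => //.
  by apply: cmeasurableM; [exact: cmeasurable_cst|exact: cmeasurable_id].
have Iz : cintegrable nu D (fun s => z * s%:C / (1 - z * s%:C)).
  apply: (@bounded_cintegrable _ _ _ mD _ 2) => // s Ds.
  have -> : z * s%:C / (1 - z * s%:C) = (1 - z * s%:C)^-1 - 1.
    by field; exact: den0.
  apply: le_trans (ler_normB _ _) _; rewrite normr1 rmorphD /= lerD // normfV.
  by rewrite invf_le1 ?den1 // (lt_le_trans _ (den1 s Ds)).
have realden s : D s -> 1 - (- y)%:C * s%:C = (1 + y * s)%:C.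
  by move=> _; rewrite rmorphN /= mulNr opprK rmorphD rmorphM rmorph1.
have dy0 s : D s -> 1 - (- y)%:C * s%:C != 0.
  by move=> Ds; rewrite realden // -[0]/(0%:C) (inj_eq (@complexI _)) gt_eqF ?den_gt0.
have Ix : cintegrable nu D (fun s => (- y)%:C * s%:C / (1 - (- y)%:C * s%:C)).
  apply: (@bounded_cintegrable _ _ _ mD _ 1) => // s Ds.
  rewrite realden // -fmorphV -!rmorphM /= !mulNr.
  have /andP[u0 u1] := u_bound s Ds.
  by rewrite normc_real lecR normrN ger0_norm.
have Ivy : nu.-integrable D (EFin \o (fun s => u s * (1 - u s) / y)).
  apply: (@bounded_Rintegrable _ _ _ mD _ (1 / y)).
    by apply: measurable_funM => //; exact: measurable_uV.
  move=> s /u_bound /andP[u0 u1].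
  by rewrite ger0_norm ?ler_wpM2r ?divr_ge0 ?invr_ge0 ?(ltW y0) //; nra.
have Ih : cintegrable nu D (fun s => h * (u s * (1 - u s) / y)%:C).
  apply: (@bounded_cintegrable _ _ _ mD _ (n * y^-1)).
    apply: cmeasurableM; first exact: cmeasurable_cst.
    split => /=; last exact: measurable_cst.
    by apply: measurable_funM => //; exact: measurable_uV.
  move=> s /u_bound /andP[u0 u1].
  rewrite normrM nE [X in _ <= X]rmorphM ler_wpM2l ?ler0c //.
  rewrite normc_real lecR.
  rewrite ger0_norm ?divr_ge0 ?(ltW y0) //; last by nra.
  by rewrite ler_pdivrMr // mulVf ?gt_eqF //; nra.
have -> : h * (v / y)%:C = cintegral nu D (fun s => h * (u s * (1 - u s) / y)%:C).
  by rewrite cintegralZr // RintegralZr //; exact: integrable_uV.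
rewrite /psiR -cintegralB // -cintegralB //; last exact: cintegrableB.
have -> : (2 / y ^+ 2)%:C * `|h| ^+ 2 = (`|n ^+ 2 / y ^+ 2| *+ 2)%:C.
  rewrite nE -rmorphXn -rmorphM /=; congr (_%:C).
  by rewrite ger0_norm ?divr_ge0 ?exprn_ge0 ?(ltW y0) // mulr2n; field; rewrite gt_eqF.
apply: normc_cintegral_le => //.
  apply: cmeasurableB; first exact: cmeasurableB.
  apply: cmeasurableM; first exact: cmeasurable_cst.
  split => /=; last exact: measurable_cst.
  by apply: measurable_funM => //; exact: measurable_uV.
move=> s Ds; set r := (X in `|X|).
have yC : y%:C != 0 :> R[i] by rewrite -[0]/(0%:C) (inj_eq (@complexI _)) gt_eqF.
have uE : (u s)%:C = y%:C * s%:C / (1 + y%:C * s%:C).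
  by rewrite /u rmorphM fmorphV rmorphD rmorphM rmorph1.
have dC : 1 + y%:C * s%:C != 0.
  by have := dy0 s Ds; rewrite rmorphN /= mulNr opprK.
(* The exact remainder for [x = - y] is [h^2 s^2 / ((1 - x s)^2 (1 - z s))], and
   [s / (1 - x s) = u s / y]. Its factors are bounded by [n ^+ 2], [(y^-1) ^+ 2] and 1. *)
have -> : r = h ^+ 2 * (u s / y)%:C ^+ 2 * (1 - z * s%:C)^-1.
  move: uE; rewrite /r -/z; move: (u s) => U uE.
  rewrite !(rmorphM, rmorphB, fmorphV) /= rmorph1 uE.
  have := den0 s Ds; rewrite /z !rmorphN /= => dz.
  by field; rewrite ?dC ?yC ?dz.
rewrite 2!normrM !normrX nE normfV.
rewrite (_ : (n ^+ 2 / y ^+ 2)%:C = n%:C ^+ 2 * (y^-1)%:C ^+ 2 * 1); last first.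
  by rewrite mulr1 -!rmorphXn -rmorphM /= exprVn.
apply: ler_pM => //.
- by rewrite mulr_ge0 ?exprn_ge0 // lecR.
- rewrite ler_wpM2l ?exprn_ge0 ?ler0c //.
  apply: lerXn2r; rewrite ?nnegrE ?normr_ge0 ?ler0c ?invr_ge0 ?(ltW y0) //.
  have /andP[u0 u1] := u_bound s Ds.
  rewrite normc_real lecR ger0_norm ?(divr_ge0 u0 (ltW y0)) //.
  by rewrite ler_pdivrMr // mulVf ?gt_eqF.
- by rewrite invf_le1 ?den1 // (lt_le_trans _ (den1 s Ds)).
Qed.

(** The inequality says that the logarithmic derivative of k, times the variable, has modulus below
    1. Applied to the measures representing [omega1] and [omega2] the lemma gives their values and
    continuity at [t]; applied to [mu1] and [mu2] it gives the contraction estimate. *)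
Lemma etaR_kfun_neg : ~ is_delta0 nu -> exists k d : R,
  [/\ `|y * d| < k, etaR nu (- y)%:C = (- y * k)%:C,
      kfun nu (- y)%:C = k%:C,
      {for ((- y)%:C : R[i]^o), continuous (etaR nu : R[i]^o -> R[i]^o)} &
      is_derive ((- y)%:C : R[i]^o) (1 : R[i]^o) (kfun nu : R[i]^o -> R[i]^o)
        d%:C].
Proof.
move=> nd.
have m0 : 0 < m := mean_gt0 nd.
have m1 : m < 1 := mean_lt1 nd.
have v0 : 0 < v := meanV_gt0 nd.
have vm : v <= m * (1 - m) := meanV_le.
have psiE : psiR nu (- y)%:C = (- m)%:C := psiR_neg.
have Dpsi := is_derive_psiR_neg.
clearbody m v.
have m1' : 1 - m != 0 by rewrite subr_eq0 gt_eqF.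
have y0' : y != 0 by rewrite gt_eqF.
have chiE : 1 + psiR nu (- y)%:C = (1 - m)%:C.
  by rewrite psiE -(rmorph1 (real_complex R)) -rmorphD.
have chi0 : 1 + psiR nu (- y)%:C != 0.
  by rewrite chiE -[0]/(0%:C) (inj_eq (@complexI _)).
have yC0 : (- y)%:C != 0 :> R[i].
  by rewrite -[0]/(0%:C) (inj_eq (@complexI _)) oppr_eq0.
have Dchi : is_derive ((- y)%:C : R[i]^o) (1 : R[i]^o)
    ((fun z => 1 + psiR nu z) : R[i]^o -> R[i]^o) (v / y)%:C.
  rewrite -[(v / y)%:C]add0r.
  exact: (@is_deriveD _ R[i]^o R[i]^o (cst 1) (psiR nu) _ _ 0 _
            (is_derive_cst _ _ _) Dpsi).
have Deta := is_derive_mulr _ _ _ _ _ _ Dpsi 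
  (is_derive_invr _ (fun z => 1 + psiR nu z) _ _ chi0 Dchi).
have Did : is_derive ((- y)%:C : R[i]^o) (1 : R[i]^o) (id : R[i]^o -> R[i]^o) 1.
  exact: is_derive_id.
have Dk := is_derive_mulr _ (etaR nu) _ _ _ _ Deta (is_derive_invr _ id _ _ yC0 Did).
have etaE : etaR nu (- y)%:C = (- y * (m / (y * (1 - m))))%:C.
  rewrite /etaR chiE psiE -fmorphV -rmorphM /=; congr (_%:C).
  by field; rewrite m1' y0'.
have eqk : y * ((m * (1 - m) - v) / (y ^+ 2 * (1 - m) ^+ 2)) =
    (m * (1 - m) - v) / (y * (1 - m) ^+ 2).
  by field; rewrite m1' y0'.
have den0 : 0 < y * (1 - m) ^+ 2 by rewrite mulr_gt0 ?exprn_gt0 ?subr_gt0.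
(* The second witness comes from the quotient rule, with [eta' = (v / y) / (1 - m)^2]. The strict
   inequality below rests on [0 < v], and [v <= m * (1 - m)] makes [d] nonnegative. *)
exists (m / (y * (1 - m))), ((m * (1 - m) - v) / (y ^+ 2 * (1 - m) ^+ 2)).
split => //.
- rewrite eqk ger0_norm ?divr_ge0 ?subr_ge0 ?(ltW den0) //.
  have -> : m / (y * (1 - m)) = m * (1 - m) / (y * (1 - m) ^+ 2).
    by field; rewrite m1' y0'.
  by rewrite ltr_pM2r ?invr_gt0 // ltrBlDr ltrDl.
- rewrite /kfun etaE -fmorphV -rmorphM /=; congr (_%:C).
  by field; rewrite m1' y0'.
- exact: is_derive_continuous Deta.
apply: is_derive_eq Dk _.
rewrite chiE psiE etaE mulr1.
rewrite -!(rmorphXn, fmorphV, rmorphN, rmorphM, rmorphD) /=.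
by congr (_%:C); field; rewrite m1' y0'.
Qed.

End at_point.
End psi_negative.

(** * Subordination at [t < 0] and the bound on the derivative of [phi] *)

Theorem corollary5p3 (R : realType) (mu1 mu2 : probability R R)
  (omega1 omega2 : R[i] -> R[i]) :
  supported_Rplus mu1 -> supported_Rplus mu2 ->
  ~ is_point_mass mu1 -> ~ is_point_mass mu2 ->
  in_Eta omega1 -> in_Eta omega2 ->
  (forall z : R[i], 0 < complex.Im z ->
     etaR mu1 (omega1 z) = omega1 z * omega2 z / z /\
     etaR mu2 (omega2 z) = omega1 z * omega2 z / z) ->
  forall t : R, t < 0 ->
    `| cderive (phi mu1 mu2 t) (omega2 t%:C) | < 1 /\
    `| t%:C ^+ 2 * cderive (kfun mu1) (omega1 t%:C)
                 * cderive (kfun mu2) (omega2 t%:C) | < 1.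
Proof.
move=> supp1 supp2 np1 np2 [nu1 [nu1s nu1d om1E]] [nu2 [nu2s nu2d om2E]] sub t t0.
have mu1d : ~ is_delta0 mu1 by move=> d0; apply: np1; exists 0.
have mu2d : ~ is_delta0 mu2 by move=> d0; apply: np2; exists 0.
have y0 : 0 < - t by rewrite oppr_gt0.
have tN : ~ in_Rplus t%:C by rewrite /in_Rplus /= => -[_]; rewrite leNgt t0.
(* With [y = - t] this yields [omega1 (t) = t * a1] and, on the next line, [omega2 (t) = t * a2],
   where [a1] and [a2] are positive; both points are thus negative reals. *)
have [a1 [b1 [ab1]]] := etaR_kfun_neg _ nu1 nu1s _ y0 nu1d.
have [a2 [b2 [ab2]]] := etaR_kfun_neg _ nu2 nu2s _ y0 nu2d.
rewrite !opprK => eta2 _ cvg2 _ eta1 _ cvg1 _.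
have a10 := le_lt_trans (normr_ge0 _) ab1.
have a20 := le_lt_trans (normr_ge0 _) ab2.
have w1 : 0 < - (t * a1) by rewrite -mulNr mulr_gt0.
have w2 : 0 < - (t * a2) by rewrite -mulNr mulr_gt0.
have [k1 [d1 [dk1]]] := etaR_kfun_neg _ mu1 supp1 _ w1 mu1d.
have [k2 [d2 [dk2]]] := etaR_kfun_neg _ mu2 supp2 _ w2 mu2d.
rewrite !opprK => eta_mu2 kE2 cmu2 Dk2 eta_mu1 kE1 cmu1 Dk1.
rewrite om1E // om2E // eta1 eta2.
(* If [F t] were nonzero, [F] would have no zero on a ball of radius [e] about [t]; but that ball
   contains [t + i e / 2], which lies in the upper half-plane. *)
have lim0 (F : R[i] -> R[i]) :
    {for (t%:C : R[i]^o), continuous (F : R[i]^o -> R[i]^o)} ->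
    (forall z : R[i], 0 < complex.Im z -> F z = 0) -> F t%:C = 0.
  move=> cF F0; apply/eqP; apply/negPn/negP => Fn0.
  have : \forall z \near (t%:C : R[i]^o), F z != 0.
    apply: (cF [set w | w != 0]); exists `|F t%:C|; first by rewrite /= normr_gt0.
    by move=> w /= lw; apply/eqP => w0; move: lw; rewrite w0 subr0 ltxx.
  move=> /nbhs_ballP[e /= e0 sub_e].
  move: (e0); rewrite ltcE => /andP[/eqP /= e1 e2].
  have := sub_e (t%:C + 'i * (complex.Re e / 2)%:C); rewrite F0.
    move=> H; suff /H : ball (t%:C : R[i]^o) e
        (t%:C + 'i * (complex.Re e / 2)%:C) by rewrite eqxx.
    rewrite -ball_normE /= opprD addNKr normrN.
    rewrite normc_def ltcE /= e1 eqxx /= !(mul0r, mulr0, mul1r, subrr, add0r).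
    rewrite oppr0 expr0n add0r sqrtr_sqr gtr0_norm ?divr_gt0 //.
    by rewrite ltr_pdivrMr // mulr_natr mulr2n ltrDl.
  by rewrite /= !(mul0r, mulr0, mul1r, subrr, add0r, addr0) divr_gt0.
have notin (z : R[i]) : 0 < complex.Im z -> ~ in_Rplus z.
  by move=> z0 [zi _]; move: z0; rewrite zi ltxx.
have z0 (z : R[i]) : 0 < complex.Im z -> z != 0.
  by apply: contraTneq => ->; rewrite ltxx.
rewrite -eta1 in cmu1; rewrite -eta2 in cmu2.
have tn0 : t != 0 by rewrite lt_eqF.
have a1n0 : a1 != 0 by rewrite gt_eqF.
have a2n0 : a2 != 0 by rewrite gt_eqF.
(* At [t] the cleared equation reads [t a1 k1 t = t a1 (t a2)], so cancelling gives
   [t * k1 = omega2 (t)]; [fix2] is its mirror image. *)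
have fix1 : k1 = a2.
  have := lim0 (fun z => etaR mu1 (etaR nu1 z) * z - etaR nu1 z * etaR nu2 z).
  rewrite eta1 eta2 eta_mu1 -!rmorphM -rmorphB /= => H.
  have {H}[] : (t * a1 * k1 * t - t * a1 * (t * a2))%:C = 0%:C :> R[i].
    apply: H.
      exact: (continuous_subordination _ _ _ _ _ _ cvg1 cmu1 cvg1 cvg2).
    move=> z iz; have [H _] := sub z iz; have nz := notin z iz.
    move: H; rewrite om1E // om2E // => ->.
    by rewrite mulfVK ?z0 ?subrr.
  move=> H; apply: (@mulfI _ (t * a1 * t)); first by rewrite !mulf_neq0.
  by transitivity (t * a1 * (t * a2)); [rewrite -(subr0_eq H)|]; ring.
have fix2 : k2 = a1.
  have := lim0 (fun z => etaR mu2 (etaR nu2 z) * z - etaR nu1 z * etaR nu2 z).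
  rewrite eta1 eta2 eta_mu2 -!rmorphM -rmorphB /= => H.
  have {H}[] : (t * a2 * k2 * t - t * a1 * (t * a2))%:C = 0%:C :> R[i].
    apply: H.
      exact: (continuous_subordination _ _ _ _ _ _ cvg2 cmu2 cvg1 cvg2).
    move=> z iz; have [_ H] := sub z iz; have nz := notin z iz.
    move: H; rewrite om1E // om2E // => ->.
    by rewrite mulfVK ?z0 ?subrr.
  move=> H; apply: (@mulfI _ (t * a2 * t)); first by rewrite !mulf_neq0.
  by transitivity (t * a1 * (t * a2)); [rewrite -(subr0_eq H)|]; ring.
have bound : `|t ^+ 2 * d1 * d2| < 1.
  (* The product of the two estimates is bounded by [k1 * k2 = a2 * a1], while
     [omega1 (t) * omega2 (t) = t^2 a1 a2]; the positive factor [a1 a2] cancels. *)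
  have := ltr_pM (normr_ge0 _) (normr_ge0 _) dk1 dk2.
  rewrite fix1 fix2 -normrM.
  have -> : - (t * a1) * d1 * (- (t * a2) * d2) = t ^+ 2 * d1 * d2 * (a2 * a1).
    by ring.
  rewrite normrM (gtr0_norm (mulr_gt0 a20 a10)).
  by rewrite gtr_pMl // mulr_gt0.
have cderiveE f (a d : R[i]) : is_derive (a : R[i]^o) (1 : R[i]^o)
    (f : R[i]^o -> R[i]^o) d -> cderive f a = d.
  by move=> Df; rewrite /cderive derive1E; apply: derive_val.
have scaled f (a d : R[i]) : is_derive (a : R[i]^o) (1 : R[i]^o)
    (f : R[i]^o -> R[i]^o) d ->
    is_derive (a : R[i]^o) (1 : R[i]^o)
      ((fun z => t%:C * f z) : R[i]^o -> R[i]^o) (t%:C * d).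
  move=> Df; have := is_derive_mulr _ (cst t%:C) f a 0 d (is_derive_cst _ _ _) Df.
  by rewrite mulr0 addr0.
have kw : t%:C * kfun mu2 (t * a2)%:C = (t * a1)%:C.
  by rewrite kE2 fix2 -rmorphM.
have Dphi : is_derive ((t * a2)%:C : R[i]^o) (1 : R[i]^o)
    (phi mu1 mu2 t : R[i]^o -> R[i]^o) (t%:C * d1%:C * (t%:C * d2%:C)).
  (* By [kw] the inner map sends [omega2 (t)] to [omega1 (t)], so the outer derivative is the one
     already known there. *)
  have D1 := scaled (kfun mu1) _ _ Dk1; rewrite -kw in D1.
  exact: (is_derive1_comp _ (fun z => t%:C * kfun mu2 z)
            (fun z => t%:C * kfun mu1 z) _ _ _ (scaled (kfun mu2) _ _ Dk2) D1).
rewrite (cderiveE _ _ _ Dphi) (cderiveE _ _ _ Dk1) (cderiveE _ _ _ Dk2).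
have -> : t%:C * d1%:C * (t%:C * d2%:C) = t%:C ^+ 2 * d1%:C * d2%:C by ring.
by rewrite -rmorphXn -!rmorphM normc_real ltcR.
Qed.
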